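(* Let $n\ge 2$ be an integer, let $k>1$ be a real number, and let $S$ be a spherical two-distance set in $\mathbf{R}^n$ with inner products $a$ and $b_k(a)$, where $$b_k(a)=\frac{ka-1}{k-1}.$$ Then $$|S|\le Q_k^{(n)}(a).$$
   Context: A spherical two-distance set in $\mathbf{R}^n$ with inner products $a$ and $b$ is a set $S$ of unit vectors in $\mathbf{R}^n$, together with real numbers $a,b\in\mathbf{I}:=[-1,1)$, such that the inner product of any two distinct vectors of $S$ is either $a$ or $b$. Gegenbauer polynomials $G_k^{(n)}(t)$, normalized by $G_k^{(n)}(1)=1$, are given by $G_0^{(n)}=1$, $G_1^{(n)}=t$, and for $k\ge 2$ $$G_k^{(n)}=\frac{(2k+n-4)\,t\,G_{k-1}^{(n)}-(k-1)\,G_{k-2}^{(n)}}{k+n-3}.$$ For given $n,a,b$, define polynomials $P_i(t)$, $i=1,\dots,5$, with Gegenbauer expansions $P_i(t)=\sum_j f_j^{(i)}G_j^{(n)}(t)$ (the sum running over $0\le j\le \deg P_i$), as follows: - $P_1(t)=(t-a)(t-b)$. - $P_2(t)=(t-a)(t-b)(t+c)$, where $c$ is determined by the equation $f_1^{(2)}=0$; it is well defined when $a+b\ne 0$, and then $c=\frac{ab(n+2)+3}{(n+2)(a+b)}$. - $P_3(t)=(t-a)(t-b)(t+a+b)$. - $P_4(t)=(t-a)(t-b)(t^2+c\,t+d)$, where $c,d$ are determined by the equations $f_1^{(4)}=f_2^{(4)}=0$. - $P_5(t)=(t-a)(t-b)(t^2+c\,t+d)$, where $c,d$ are determined by the equations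 $f_2^{(5)}=f_3^{(5)}=0$. Here $P_i$ is called well defined if the stated equations determine its parameters ($c$, or $c$ and $d$) uniquely; $P_1$ and $P_3$ are always well defined. $D_i^{(n)}$ denotes the set of all pairs $(a,b)\in\mathbf{I}^2$ such that $P_i$ is well defined, all coefficients $f_j^{(i)}\ge 0$, and $f_0^{(i)}>0$. For $(a,b)\in D_i^{(n)}$ put $U_i^{(n)}(a,b):=P_i(1)/f_0^{(i)}$. $D_{i,k}^{(n)}$ denotes the set of all real numbers $a$ such that $(a,b_k(a))\in D_i^{(n)}$. Define $$R_{i,k}^{(n)}(a):=\begin{cases}U_i^{(n)}(a,b_k(a)) & \text{if } a\in D_{i,k}^{(n)},\\ \infty & \text{if } a\notin D_{i,k}^{(n)},\end{cases}\qquad Q_k^{(n)}(a):=\min_{1\le i\le 5} R_{i,k}^{(n)}(a).$$ *)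

(* Defs.v *)
From mathcomp Require Import all_boot all_order all_algebra.
From mathcomp Require Import all_classical all_reals all_analysis.
From mathcomp Require Import zify.

Set Implicit Arguments.
Unset Strict Implicit.
Unset Printing Implicit Defensive.
Import Order.TTheory GRing.Theory Num.Theory.

Local Open Scope classical_set_scope.
Local Open Scope ring_scope.

Section TwoDistance.
Context {R : realType}.

Definition inner_product (n : nat) (x y : 'rV[R]_n) : R :=
  \sum_(i < n) x 0 i * y 0 i.

Definition II : set R := [set t | -1 <= t < 1].

(* The values a and b need not both be attained, and S may be infinite. *)
Definition spherical_two_distance_set (n : nat) (a b : R)
    (S : set 'rV[R]_n) : Prop :=
  [/\ II a, II b,
      forall x, S x -> inner_product x x = 1
    & forall x y, S x -> S y -> x <> y ->
        inner_product x y = a \/ inner_product x y = b].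

Fixpoint gegenbauer (n k : nat) : {poly R} :=
  match k with
  | 0 => 1
  | 1 => 'X
  | (m.+1 as k1).+1 =>
      let kR : R := k%:R in
      let nR : R := n%:R in
      (kR + nR - 3)^-1 *:
        ((2 * kR + nR - 4) *: ('X * gegenbauer n k1)
         - (kR - 1) *: gegenbauer n m)
  end.

Definition gegenbauer_expansion (n : nat) (p : {poly R}) (f : nat -> R) : Prop :=
  p = \sum_(j < size p) f j *: gegenbauer n j
  /\ forall j, (size p <= j)%N -> f j = 0.

(* For n >= 2 the expansion exists and is unique (gegenbauer_coefP and
   gegenbauer_expansion_uniq below). *)
Definition gegenbauer_coef (n : nat) (p : {poly R}) : nat -> R :=
  xget (fun=> 0) [set f | gegenbauer_expansion n p f].

Definition P1 (a b : R) : {poly R} := ('X - a%:P) * ('X - b%:P).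
Definition P2 (a b c : R) : {poly R} :=
  ('X - a%:P) * ('X - b%:P) * ('X + c%:P).
Definition P3 (a b : R) : {poly R} :=
  ('X - a%:P) * ('X - b%:P) * ('X + a%:P + b%:P).
Definition P45 (a b c d : R) : {poly R} :=
  ('X - a%:P) * ('X - b%:P) * ('X^2 + c *: 'X + d%:P).

Definition params2 (n : nat) (a b : R) : set R :=
  [set c | gegenbauer_coef n (P2 a b c) 1 = 0].
Definition params4 (n : nat) (a b : R) : set (R * R) :=
  [set cd | gegenbauer_coef n (P45 a b cd.1 cd.2) 1 = 0
         /\ gegenbauer_coef n (P45 a b cd.1 cd.2) 2 = 0].
Definition params5 (n : nat) (a b : R) : set (R * R) :=
  [set cd | gegenbauer_coef n (P45 a b cd.1 cd.2) 2 = 0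
         /\ gegenbauer_coef n (P45 a b cd.1 cd.2) 3 = 0].

Definition well_defined (n i : nat) (a b : R) : Prop :=
  match i with
  | 1 | 3 => True
  | 2 => exists! c, params2 n a b c
  | 4 => exists! cd, params4 n a b cd
  | 5 => exists! cd, params5 n a b cd
  | _ => False
  end.

(* Only meaningful when [well_defined n i a b] holds; otherwise [xget] may
   return an arbitrary solution or the default value. *)
Definition P (n i : nat) (a b : R) : {poly R} :=
  match i with
  | 1 => P1 a b
  | 2 => P2 a b (xget 0 (params2 n a b))
  | 3 => P3 a b
  | 4 => let cd := xget (0, 0) (params4 n a b) in P45 a b cd.1 cd.2
  | 5 => let cd := xget (0, 0) (params5 n a b) in P45 a b cd.1 cd.2
  | _ => 0
  end.

Definition D (n i : nat) : set (R * R) :=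
  [set ab | [/\ II ab.1, II ab.2, well_defined n i ab.1 ab.2,
      forall j, (j < size (P n i ab.1 ab.2))%N ->
        0 <= gegenbauer_coef n (P n i ab.1 ab.2) j
    & 0 < gegenbauer_coef n (P n i ab.1 ab.2) 0]].

Definition U (n i : nat) (a b : R) : R :=
  (P n i a b).[1] / gegenbauer_coef n (P n i a b) 0.

Definition bk (k a : R) : R := (k * a - 1) / (k - 1).

Definition Dk (n i : nat) (k : R) : set R := [set a | D n i (a, bk k a)].

Definition Rk (n i : nat) (k a : R) : \bar R :=
  if `[< Dk n i k a >] then (U n i a (bk k a))%:E else +oo%E.

Definition Q (n : nat) (k a : R) : \bar R :=
  \big[Order.min/+oo%E]_(1 <= i < 6) Rk n i k a.

Lemma size_gegenbauer (n k : nat) : (2 <= n)%N -> size (gegenbauer n k) = k.+1.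
Proof.
move=> n2; elim/ltn_ind: k => -[|[|m]] IH; rewrite ?size_poly1 ?size_polyX//.
have s1 := IH m.+1 (ltnSn _); have s0 := IH m (leqnSn _).
have den : (m.+2%:R + n%:R - 3 : R) != 0.
  rewrite -natrD -natrB ?pnatr_eq0; lia.
have num : (2 * m.+2%:R + n%:R - 4 : R) != 0.
  rewrite -natrM -natrD -natrB ?pnatr_eq0; lia.
have g0 : gegenbauer n m.+1 != 0 by rewrite -size_poly_gt0 s1.
rewrite /= -/(gegenbauer n m.+1) size_scale ?invr_eq0// size_polyDl.
  by rewrite size_scale// mulrC size_mulX// s1.
rewrite size_polyN [ltnRHS]size_scale// mulrC size_mulX// s1.
by apply: leq_ltn_trans (size_scale_leq _ _) _; rewrite s0.
Qed.

Lemma gegenbauer_sum_exists (n m : nat) (p : {poly R}) : (2 <= n)%N ->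
  (size p <= m)%N -> exists f : nat -> R, p = \sum_(j < m) f j *: gegenbauer n j.
Proof.
move=> n2; elim: m p => [|m IH] p pm.
  exists (fun=> 0); rewrite big_ord0; apply/eqP; by rewrite -size_poly_leq0.
have sG := size_gegenbauer m n2.
have lG : (gegenbauer n m)`_m != 0.
  have := lead_coefE (gegenbauer n m); rewrite sG /= => <-.
  by rewrite lead_coef_eq0 -size_poly_gt0 sG.
pose c := p`_m / (gegenbauer n m)`_m.
have [|f pf] := IH (p - c *: gegenbauer n m).
  apply/leq_sizeP => j; rewrite leq_eqVlt => /predU1P[<-|mj].
    by rewrite coefB coefZ /c divfK ?subrr.
  rewrite coefB coefZ [p`_j]nth_default ?(leq_trans pm)//.
  by rewrite [_`_j]nth_default ?sG// mulr0 subrr.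
exists (fun j => if (j == m)%N then c else f j).
rewrite big_ord_recr /= eqxx -[LHS](subrK (c *: gegenbauer n m)) pf.
by congr (_ + _); apply: eq_bigr => i _; rewrite ltn_eqF.
Qed.

Lemma gegenbauer_coefP (n : nat) (p : {poly R}) : (2 <= n)%N ->
  gegenbauer_expansion n p (gegenbauer_coef n p).
Proof.
move=> n2; have [f pf] := gegenbauer_sum_exists n2 (leqnn (size p)).
apply: (@xgetPex _ _ [set f | gegenbauer_expansion n p f]).
exists (fun j => if (j < size p)%N then f j else 0); split=> [|j].
  by rewrite [LHS]pf; apply: eq_bigr => i _; rewrite ltn_ord.
by rewrite leqNgt => /negbTE ->.
Qed.

Lemma gegenbauer_sum_eq0 (n m : nat) (f : nat -> R) : (2 <= n)%N ->
  \sum_(j < m) f j *: gegenbauer n j = 0 -> forall j, (j < m)%N -> f j = 0.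
Proof.
move=> n2; elim: m => [|m IH]// s0.
have fm : f m = 0.
  have sG := size_gegenbauer m n2.
  have := congr1 (fun q : {poly R} => q`_m) s0.
  rewrite big_ord_recr /= coefD coef_sum big1 => [|i _].
    rewrite coef0 coefZ add0r => /eqP; rewrite mulf_eq0 => /predU1P[//|].
    have := lead_coefE (gegenbauer n m); rewrite sG /= => <-.
    by rewrite lead_coef_eq0 -size_poly_eq0 sG.
  by rewrite coefZ [_`_m]nth_default ?mulr0// size_gegenbauer.
move=> j; rewrite ltnS leq_eqVlt => /predU1P[->//|]; apply: IH.
by move: s0; rewrite big_ord_recr /= fm scale0r addr0.
Qed.

Lemma gegenbauer_expansion_uniq (n : nat) (p : {poly R}) (f g : nat -> R) :
  (2 <= n)%N -> gegenbauer_expansion n p f -> gegenbauer_expansion n p g ->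
  f =1 g.
Proof.
move=> n2 [pf f0] [pg g0] j; have [/[dup] /f0 -> /g0 ->//|jp] := leqP (size p) j.
apply/eqP; rewrite -subr_eq0; apply/eqP.
apply: (gegenbauer_sum_eq0 (f := fun j => f j - g j) n2 _ jp).
under eq_bigr do rewrite scalerBl.
by rewrite sumrB -pf -pg subrr.
Qed.

End TwoDistance.

(* Main.v *)
Require Import Defs.
From mathcomp Require Import all_boot all_order all_algebra.
From mathcomp Require Import all_classical all_reals all_analysis.
From mathcomp Require Import finmap ring lra zify.

Set Implicit Arguments.
Unset Strict Implicit.
Unset Printing Implicit Defensive.
Import Order.TTheory GRing.Theory Num.Theory.

Local Open Scope classical_set_scope.
Local Open Scope ring_scope.

(** Delsarte's linear programming bound.  For a finite subset s of S and
    f = f_j^(i), the sum of P_i(<x, y>) over s^2 only sees its diagonal, since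
    P_i vanishes at both inner products, so it equals |s| P_i(1).  Expanding P_i
    it is also the sum of the f_j G_j(<x, y>), which is at least f_0 |s|^2 because
    every Gegenbauer kernel is positive semidefinite on the sphere.  Only degrees
    at most 4 occur; for them G_j(<x, y>) is a nonnegative multiple of <T_j(x),
    T_j(y)>, where T_j(x) is the traceless part of the j-th tensor power of x, so
    the double sum of G_j is a multiple of the squared norm of the sum of T_j. *)

Section HarmonicTensors.
Context {R : realFieldType}.

(** The double sum of inner products is the squared norm of the sum of the vectors [f x]. *)
Lemma gram_sum_ge0 (V : Type) (J : finType) (f : V -> J -> R) (s : seq V) :
  0 <= \sum_(x <- s) \sum_(y <- s) \sum_j f x j * f y j.
Proof.
have -> : \sum_(x <- s) \sum_(y <- s) \sum_j f x j * f y j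
    = \sum_j (\sum_(x <- s) f x j) ^+ 2.
  rewrite [RHS](eq_bigr (fun j => \sum_(x <- s) \sum_(y <- s) f x j * f y j)).
    by rewrite [RHS]exchange_big; apply: eq_bigr => x _; rewrite exchange_big.
  by move=> j _; rewrite expr2 mulr_suml; apply: eq_bigr => x _; rewrite mulr_sumr.
by apply: sumr_ge0 => j _; apply: sqr_ge0.
Qed.

(** * Traceless parts of the tensor powers of a unit vector *)

Variable n : nat.
Local Notation I := 'I_n.
Implicit Types (x y : 'I_n -> R) (i j k l : 'I_n).

Definition dot x y : R := \sum_i x i * y i.

Definition kron i j : R := (i == j)%:R.

Lemma kronC i j : kron i j = kron j i. Proof. by rewrite /kron eq_sym. Qed.
Lemma kron1 i : kron i i = 1. Proof. by rewrite /kron eqxx. Qed.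

Lemma sum_kron (f : I -> R) j : \sum_i kron i j * f i = f j.
Proof.
rewrite (bigD1 j) //= kron1 mul1r big1 ?addr0// => i /negbTE ij.
by rewrite /kron ij mul0r.
Qed.

(** In these three tensors |x|^2 is already replaced by 1, so they are the traceless parts of the
    powers of [x] only when [dot x x = 1]. *)
Definition tensor2 x i j : R := x i * x j - n%:R^-1 * kron i j.

Definition tensor3 x i j k : R :=
  x i * x j * x k
  - (n%:R + 2)^-1 * (kron i j * x k + kron i k * x j + kron j k * x i).

Definition tensor4 x i j k l : R :=
  x i * x j * x k * x l
  - (n%:R + 4)^-1 *
      (kron i j * (x k * x l) + kron i k * (x j * x l) + kron i l * (x j * x k)
       + kron j k * (x i * x l) + kron j l * (x i * x k)
       + kron k l * (x i * x j))
  + ((n%:R + 2) * (n%:R + 4))^-1 *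
      (kron i j * kron k l + kron i k * kron j l + kron i l * kron j k).

Let den2 : (n%:R + 2 : R) != 0.
Proof. by rewrite -natrD pnatr_eq0 addn2. Qed.
Let den4 : (n%:R + 4 : R) != 0.
Proof. by rewrite -natrD pnatr_eq0 addn4. Qed.

Lemma tensor2_trace x : (0 < n)%N -> dot x x = 1 -> \sum_i tensor2 x i i = 0.
Proof.
move=> n0 x1; rewrite sumrB [X in X - _]x1.
under eq_bigr do rewrite kron1 mulr1.
by rewrite sumr_const card_ord -[_ *+ _]mulr_natr mulVf ?subrr// pnatr_eq0 -lt0n.
Qed.

(** Contracting [i] with [j] turns the bracket of [tensor3] into (n + 2) x_k, which its coefficient
    reduces to x_k. *)
Lemma tensor3_trace x k : dot x x = 1 -> \sum_i tensor3 x i i k = 0.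
Proof.
move=> x1.
rewrite (eq_bigr (fun i => x i * x i * x k - (n%:R + 2)^-1 * x k
   - (n%:R + 2)^-1 * 2 * (kron i k * x i))) => [|i _]; last first.
  by rewrite /tensor3 kron1; ring.
rewrite !sumrB -mulr_suml [X in X * _]x1 sumr_const card_ord -mulr_sumr sum_kron.
by rewrite -mulr_natl; field.
Qed.

(** Under the contraction the first bracket of [tensor4] becomes (n + 4) x_k x_l + [kron k l] and
    the second (n + 2) [kron k l]; the two coefficients make everything cancel. *)
Lemma tensor4_trace x k l : dot x x = 1 -> \sum_i tensor4 x i i k l = 0.
Proof.
move=> x1; pose p : R := (n%:R + 4)^-1.
pose q : R := ((n%:R + 2) * (n%:R + 4))^-1.
(* [c] is kept abstract so that [big_split] does not distribute over it. *)
have [c cE] : exists c, c = q * kron k l - p * (x k * x l).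
  by exists (q * kron k l - p * (x k * x l)).
rewrite (eq_bigr (fun i => x i * x i * (x k * x l - p * kron k l) + c
   + kron i k * (2 * q * kron i l - 2 * p * x i * x l)
   - kron i l * (2 * p * x i * x k))) => [|i _]; last first.
  by rewrite cE /tensor4 kron1 -/p -/q; ring.
rewrite sumrB !big_split /= -mulr_suml [X in X * _]x1 !sum_kron.
by rewrite sumr_const card_ord -[_ *+ n]mulr_natl cE /p /q; field; rewrite den2 den4.
Qed.

(** * Sums over multi-indices and their symmetries *)

Definition sum2 (F : I -> I -> R) := \sum_i \sum_j F i j.
Definition sum3 (F : I -> I -> I -> R) := \sum_i \sum_j \sum_k F i j k.
Definition sum4 (F : I -> I -> I -> I -> R) :=
  \sum_i \sum_j \sum_k \sum_l F i j k l.

Lemma eq_sum3 (F G : I -> I -> I -> R) :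
  (forall i j k, F i j k = G i j k) -> sum3 F = sum3 G.
Proof. by move=> FG; do 3!apply: eq_bigr => ? _. Qed.

Lemma eq_sum4 (F G : I -> I -> I -> I -> R) :
  (forall i j k l, F i j k l = G i j k l) -> sum4 F = sum4 G.
Proof. by move=> FG; do 4!apply: eq_bigr => ? _. Qed.

(** Adjacent transpositions generate all permutations of the summation indices. *)
Lemma sum3C12 F : sum3 F = sum3 (fun i j k => F j i k).
Proof. by rewrite /sum3 exchange_big. Qed.
Lemma sum3C23 F : sum3 F = sum3 (fun i j k => F i k j).
Proof. by apply: eq_bigr => i _; rewrite exchange_big. Qed.
Lemma sum4C12 F : sum4 F = sum4 (fun i j k l => F j i k l).
Proof. by rewrite /sum4 exchange_big. Qed.
Lemma sum4C23 F : sum4 F = sum4 (fun i j k l => F i k j l).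
Proof. by apply: eq_bigr => i _; rewrite exchange_big. Qed.
Lemma sum4C34 F : sum4 F = sum4 (fun i j k l => F i j l k).
Proof. by do 2!apply: eq_bigr => ? _; rewrite exchange_big. Qed.

Lemma sum3D F G : sum3 (fun i j k => F i j k + G i j k) = sum3 F + sum3 G.
Proof. by rewrite -big_split; do 2!(apply: eq_bigr => ? _; rewrite -big_split). Qed.
Lemma sum3Z c F : sum3 (fun i j k => c * F i j k) = c * sum3 F.
Proof. by rewrite mulr_sumr; do 2!(apply: eq_bigr => ? _; rewrite mulr_sumr). Qed.
Lemma sum4D F G : sum4 (fun i j k l => F i j k l + G i j k l) = sum4 F + sum4 G.
Proof. by rewrite -big_split; do 3!(apply: eq_bigr => ? _; rewrite -big_split). Qed.
Lemma sum4Z c F : sum4 (fun i j k l => c * F i j k l) = c * sum4 F.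
Proof. by rewrite mulr_sumr; do 3!(apply: eq_bigr => ? _; rewrite mulr_sumr). Qed.

Lemma sum3M (A : I -> I -> R) (g : I -> R) :
  sum3 (fun i j k => A i j * g k) = sum2 A * \sum_k g k.
Proof.
rewrite /sum3 /sum2 mulr_suml; apply: eq_bigr => i _; rewrite mulr_suml.
by apply: eq_bigr => j _; rewrite mulr_sumr.
Qed.

Lemma sum4M (A B : I -> I -> R) :
  sum4 (fun i j k l => A i j * B k l) = sum2 A * sum2 B.
Proof.
rewrite /sum4 /sum2 mulr_suml; apply: eq_bigr => i _; rewrite mulr_suml.
apply: eq_bigr => j _; rewrite mulr_sumr; apply: eq_bigr => k _.
by rewrite mulr_sumr.
Qed.

Lemma sum2M (g h : I -> R) : sum2 (fun i j => g i * h j) = (\sum_i g i) * \sum_i h i.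
Proof. by rewrite /sum2 mulr_suml; apply: eq_bigr => i _; rewrite mulr_sumr. Qed.

Lemma sum2_kron (f : I -> I -> R) : sum2 (fun i j => kron i j * f i j) = \sum_i f i i.
Proof.
rewrite /sum2; apply: eq_bigr => i _; rewrite -[RHS](sum_kron (f i)).
by apply: eq_bigr => j _; rewrite kronC.
Qed.

Lemma sum3_sym (A : I -> I -> R) (g : I -> R) :
  sum3 (fun i j k => A i j * g k + A i k * g j + A j k * g i)
    = 3 * (sum2 A * \sum_k g k).
Proof.
have e13 : sum3 (fun i j k => A i k * g j) = sum2 A * \sum_k g k.
  by rewrite sum3C23 sum3M.
have e23 : sum3 (fun i j k => A j k * g i) = sum2 A * \sum_k g k.
  by rewrite sum3C12 e13.
by rewrite !sum3D sum3M e13 e23; ring.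
Qed.

Lemma sum4_sym (A B : I -> I -> R) :
  sum4 (fun i j k l => A i j * B k l + A i k * B j l + A i l * B j k)
    = 3 * (sum2 A * sum2 B).
Proof.
have e13 : sum4 (fun i j k l => A i k * B j l) = sum2 A * sum2 B.
  by rewrite sum4C23 sum4M.
have e14 : sum4 (fun i j k l => A i l * B j k) = sum2 A * sum2 B.
  by rewrite sum4C34 e13.
by rewrite !sum4D sum4M e13 e14; ring.
Qed.

(** Here [A] sits on the three pairs avoiding [i]; with [sum4_sym] this covers all six pairs of
    indices. *)
Lemma sum4_sym_compl (A B : I -> I -> R) :
  sum4 (fun i j k l => A j k * B i l + A j l * B i k + A k l * B i j)
    = 3 * (sum2 A * sum2 B).
Proof.
have e12 : sum4 (fun i j k l => A k l * B i j) = sum2 A * sum2 B.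
  (* The four transpositions compose to the exchange of the pair (i, j) with the pair (k, l). *)
  by rewrite -sum4M sum4C23 sum4C12 sum4C34 sum4C23; apply: eq_sum4 => *; rewrite mulrC.
have e13 : sum4 (fun i j k l => A j l * B i k) = sum2 A * sum2 B.
  by rewrite sum4C23 e12.
have e14 : sum4 (fun i j k l => A j k * B i l) = sum2 A * sum2 B.
  by rewrite sum4C34 e13.
by rewrite !sum4D e12 e13 e14; ring.
Qed.

(** * Inner products of traceless tensors as polynomials in [dot x y] *)

Lemma dot_tensor2 x y : (0 < n)%N -> dot x x = 1 -> dot y y = 1 ->
  sum2 (fun i j => tensor2 x i j * tensor2 y i j) = dot x y ^+ 2 - n%:R^-1.
Proof.
move=> n0 x1 y1; pose g i := x i * y i.
(* Only [tensor2 y] is split: its trace part is paired with the traceless [tensor2 x] and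
   contributes 0, which leaves the pairing of [tensor2 x] with y_i y_j. *)
transitivity (sum2 (fun i j => g i * g j)
    + sum2 (fun i j => kron i j * (- n%:R^-1 * (y i * y j)))
    + sum2 (fun i j => kron i j * (- n%:R^-1 * tensor2 x i j))).
  rewrite -!big_split; apply: eq_bigr => i _; rewrite -!big_split.
  by apply: eq_bigr => j _; rewrite /tensor2 /g /=; ring.
rewrite sum2M !sum2_kron -!mulr_sumr tensor2_trace// -/(dot y y) y1.
by rewrite mulr0 addr0 mulr1 expr2.
Qed.

(** Each Kronecker symbol contracts two indices of [T]; symmetry moves them to the front, where the
    trace vanishes. [contract4_eq0] works the same way. *)
Lemma contract3_eq0 (T : I -> I -> I -> R) (w : I -> R) :
  (forall i j k, T i j k = T j i k) -> (forall i j k, T i j k = T i k j) ->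
  (forall k, \sum_i T i i k = 0) ->
  sum3 (fun i j k =>
    T i j k * (kron i j * w k + kron i k * w j + kron j k * w i)) = 0.
Proof.
move=> TC12 TC23 T0.
have c12 : sum3 (fun i j k => T i j k * (kron i j * w k)) = 0.
  (* Makes [k] the outermost index, so that the inner double sum is a trace. *)
  rewrite sum3C23 sum3C12.
  rewrite /sum3 big1// => k _.
  transitivity (sum2 (fun i j => kron i j * (T i j k * w k))).
    by do 2!apply: eq_bigr => ? _; ring.
  by rewrite sum2_kron -mulr_suml T0 mul0r.
have c13 : sum3 (fun i j k => T i j k * (kron i k * w j)) = 0.
  by rewrite -[RHS]c12 sum3C23; apply: eq_sum3 => *; rewrite TC23.
have c23 : sum3 (fun i j k => T i j k * (kron j k * w i)) = 0.
  by rewrite -[RHS]c13 sum3C12; apply: eq_sum3 => *; rewrite TC12.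
transitivity (sum3 (fun i j k => T i j k * (kron i j * w k)
    + T i j k * (kron i k * w j) + T i j k * (kron j k * w i))).
  by apply: eq_sum3 => *; rewrite !mulrDr.
by rewrite !sum3D c12 c13 c23 !addr0.
Qed.

Lemma contract4_eq0 (T : I -> I -> I -> I -> R) (w : I -> I -> R) :
  (forall i j k l, T i j k l = T j i k l) ->
  (forall i j k l, T i j k l = T i k j l) ->
  (forall i j k l, T i j k l = T i j l k) ->
  (forall k l, \sum_i T i i k l = 0) ->
  sum4 (fun i j k l => T i j k l *
    (kron i j * w k l + kron i k * w j l + kron i l * w j k
     + kron j k * w i l + kron j l * w i k + kron k l * w i j)) = 0.
Proof.
move=> TC12 TC23 TC34 T0.
have c12 : sum4 (fun i j k l => T i j k l * (kron i j * w k l)) = 0.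
  rewrite sum4C23 sum4C34 sum4C12 sum4C23 /sum4.
  rewrite big1// => k _; rewrite big1// => l _.
  transitivity (sum2 (fun i j => kron i j * (T i j k l * w k l))).
    by do 2!apply: eq_bigr => ? _; ring.
  by rewrite sum2_kron -mulr_suml T0 mul0r.
have c13 : sum4 (fun i j k l => T i j k l * (kron i k * w j l)) = 0.
  by rewrite -[RHS]c12 sum4C23; apply: eq_sum4 => *; rewrite TC23.
have c14 : sum4 (fun i j k l => T i j k l * (kron i l * w j k)) = 0.
  by rewrite -[RHS]c13 sum4C34; apply: eq_sum4 => *; rewrite TC34.
have c23 : sum4 (fun i j k l => T i j k l * (kron j k * w i l)) = 0.
  by rewrite -[RHS]c13 sum4C12; apply: eq_sum4 => *; rewrite TC12.
have c24 : sum4 (fun i j k l => T i j k l * (kron j l * w i k)) = 0.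
  by rewrite -[RHS]c23 sum4C34; apply: eq_sum4 => *; rewrite TC34.
have c34 : sum4 (fun i j k l => T i j k l * (kron k l * w i j)) = 0.
  by rewrite -[RHS]c24 sum4C23; apply: eq_sum4 => *; rewrite TC23.
transitivity (sum4 (fun i j k l => T i j k l * (kron i j * w k l)
    + T i j k l * (kron i k * w j l) + T i j k l * (kron i l * w j k)
    + T i j k l * (kron j k * w i l) + T i j k l * (kron j l * w i k)
    + T i j k l * (kron k l * w i j))).
  by apply: eq_sum4 => *; rewrite !mulrDr.
by rewrite !sum4D c12 c13 c14 c23 c24 c34 !addr0.
Qed.

Lemma dot_tensor3 x y : dot x x = 1 -> dot y y = 1 ->
  sum3 (fun i j k => tensor3 x i j k * tensor3 y i j k)
    = dot x y ^+ 3 - 3 / (n%:R + 2) * dot x y.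
Proof.
move=> x1 y1; pose p : R := (n%:R + 2)^-1.
(* [A] is what a Kronecker symbol of [tensor3 x] leaves when paired with the powers of [y]; it sums
   to |y|^2 = 1. *)
pose g i := x i * y i; pose A i j := kron i j * (y i * y j).
have sA : sum2 A = 1 by rewrite sum2_kron.
transitivity (sum3 (fun i j k => (g i * g j) * g k
    + (- p) * (A i j * g k + A i k * g j + A j k * g i)
    + tensor3 x i j k * (kron i j * (- p * y k) + kron i k * (- p * y j)
                         + kron j k * (- p * y i)))).
  by apply: eq_sum3 => i j k; rewrite /tensor3 /g /A -/p; ring.
rewrite !sum3D sum3Z sum3_sym contract3_eq0.
- by rewrite (sum3M (fun i j => g i * g j)) sum2M sA -/(dot x y) /p; field.
- by move=> i j k; rewrite /tensor3 (kronC j i); ring.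
- by move=> i j k; rewrite /tensor3 (kronC k j); ring.
- by move=> k; apply: tensor3_trace.
Qed.

Lemma dot_tensor4 x y : dot x x = 1 -> dot y y = 1 ->
  sum4 (fun i j k l => tensor4 x i j k l * tensor4 y i j k l)
    = dot x y ^+ 4 - 6 / (n%:R + 4) * dot x y ^+ 2
      + 3 / ((n%:R + 2) * (n%:R + 4)).
Proof.
move=> x1 y1; pose p : R := (n%:R + 4)^-1.
pose q : R := ((n%:R + 2) * (n%:R + 4))^-1.
pose g i := x i * y i; pose A i j := kron i j * (y i * y j).
pose B i j := g i * g j.
have sA : sum2 A = 1 by rewrite sum2_kron.
have sB : sum2 B = dot x y ^+ 2 by rewrite sum2M expr2.
(* The trace terms of [tensor4 y], with [q] split over the two factors of each
   product of Kronecker symbols; [tensor4 x] is traceless, so they contribute 0. *)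
pose w k l : R := q / 2 * kron k l - p * (y k * y l).
transitivity (sum4 (fun i j k l => B i j * B k l
    + (- p) * (A i j * B k l + A i k * B j l + A i l * B j k)
    + (- p) * (A j k * B i l + A j l * B i k + A k l * B i j)
    + q * (A i j * A k l + A i k * A j l + A i l * A j k)
    + tensor4 x i j k l *
       (kron i j * w k l + kron i k * w j l + kron i l * w j k
     + kron j k * w i l + kron j l * w i k + kron k l * w i j))).
  by apply: eq_sum4 => i j k l; rewrite /tensor4 /B /A /g /w -/p -/q; field.
rewrite !sum4D !sum4Z !sum4_sym sum4_sym_compl sum4M contract4_eq0.
- by rewrite sA sB /p /q; field; rewrite den2 den4.
- by move=> i j k l; rewrite /tensor4 (kronC j i); ring.
- by move=> i j k l; rewrite /tensor4 (kronC k j); ring.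
- by move=> i j k l; rewrite /tensor4 (kronC l k); ring.
- by move=> k l; apply: tensor4_trace.
Qed.

(** * Positive semidefiniteness of the tensor kernels *)

Lemma tensor2_gram_ge0 (s : seq (I -> R)) :
  0 <= \sum_(x <- s) \sum_(y <- s)
         sum2 (fun i j => tensor2 x i j * tensor2 y i j).
Proof.
(* A tensor is read as a vector indexed by its multi-indices [u]. *)
apply: le_trans (gram_sum_ge0 (fun x (u : I * I) => tensor2 x u.1 u.2) s) _.
rewrite le_eqVlt; apply/orP; left; apply/eqP/eq_bigr => x _.
by apply: eq_bigr => y _; rewrite /sum2 pair_bigA.
Qed.

Lemma tensor3_gram_ge0 (s : seq (I -> R)) :
  0 <= \sum_(x <- s) \sum_(y <- s)
         sum3 (fun i j k => tensor3 x i j k * tensor3 y i j k).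
Proof.
apply: le_trans
  (gram_sum_ge0 (fun x (u : I * I * I) => tensor3 x u.1.1 u.1.2 u.2) s) _.
rewrite le_eqVlt; apply/orP; left; apply/eqP/eq_bigr => x _.
by apply: eq_bigr => y _; rewrite /sum3 !pair_bigA.
Qed.

Lemma tensor4_gram_ge0 (s : seq (I -> R)) :
  0 <= \sum_(x <- s) \sum_(y <- s)
         sum4 (fun i j k l => tensor4 x i j k l * tensor4 y i j k l).
Proof.
apply: le_trans (gram_sum_ge0
  (fun x (u : I * I * I * I) => tensor4 x u.1.1.1 u.1.1.2 u.1.2 u.2) s) _.
rewrite le_eqVlt; apply/orP; left; apply/eqP/eq_bigr => x _.
by apply: eq_bigr => y _; rewrite /sum4 !pair_bigA.
Qed.

End HarmonicTensors.

(** * Gegenbauer polynomials of degree at most 4 on the sphere *)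

Section GegenbauerPositivity.
Context {R : realType} (n : nat) (n2 : (2 <= n)%N).

(** At t = 1 the recurrence weights 2k + n - 4 and -(k - 1) add up to the divisor k + n - 3. *)
Lemma gegenbauer_horner1 (j : nat) : (gegenbauer n j).[1] = 1 :> R.
Proof.
elim/ltn_ind: j => -[|[|j]] IH; [by rewrite hornerC|by rewrite hornerX|].
rewrite /= -/(gegenbauer n j.+1) hornerZ hornerD hornerN !hornerZ hornerM.
rewrite hornerX (IH j.+1)// (IH j)// mul1r !mulr1.
have nge2 : 2 <= n%:R :> R by rewrite ler_nat.
have : 2 <= j.+2%:R :> R by rewrite ler_nat.
by move: j.+2%:R => m m2; field; apply: lt0r_neq0; lra.
Qed.

(** In degrees 2 to 4 the last factor is the inner product found in [dot_tensor2], [dot_tensor3] or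
    [dot_tensor4], and the constant in front is nonnegative for n >= 2. *)
Lemma gegenbauer2E (t : R) :
  (gegenbauer n 2).[t] = n%:R / (n%:R - 1) * (t ^+ 2 - n%:R^-1).
Proof.
have nge2 : 2 <= n%:R :> R by rewrite ler_nat.
rewrite /= !(hornerZ, hornerD, hornerN, hornerM, hornerX, hornerC).
field.
by rewrite !lt0r_neq0//; lra.
Qed.

Lemma gegenbauer3E (t : R) :
  (gegenbauer n 3).[t] =
    (n%:R + 2) / (n%:R - 1) * (t ^+ 3 - 3 / (n%:R + 2) * t).
Proof.
have nge2 : 2 <= n%:R :> R by rewrite ler_nat.
rewrite /= !(hornerZ, hornerD, hornerN, hornerM, hornerX, hornerC).
field.
by rewrite !lt0r_neq0//; lra.
Qed.

Lemma gegenbauer4E (t : R) :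
  (gegenbauer n 4).[t] =
    (n%:R + 2) * (n%:R + 4) / ((n%:R - 1) * (n%:R + 1)) *
      (t ^+ 4 - 6 / (n%:R + 4) * t ^+ 2 + 3 / ((n%:R + 2) * (n%:R + 4))).
Proof.
have nge2 : 2 <= n%:R :> R by rewrite ler_nat.
rewrite /= !(hornerZ, hornerD, hornerN, hornerM, hornerX, hornerC).
field.
by rewrite !lt0r_neq0//; lra.
Qed.

Lemma gegenbauer_gram_ge0 (s : seq 'rV[R]_n) (j : nat) :
  (forall x, x \in s -> inner_product x x = 1) -> (j < 5)%N ->
  0 <= \sum_(x <- s) \sum_(y <- s) (gegenbauer n j).[inner_product x y].
Proof.
move=> s1 j5; have nge2 : 2 <= n%:R :> R by rewrite ler_nat.
(* Reduces each degree to a kernel [F] with nonnegative double sum; the identity is asked only on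
   [s], because the tensor formulas need unit vectors. *)
have scaled (F : 'rV[R]_n -> 'rV[R]_n -> R) (c : R) : 0 <= c ->
    0 <= \sum_(x <- s) \sum_(y <- s) F x y ->
    {in s &, forall x y, (gegenbauer n j).[inner_product x y] = c * F x y} ->
    0 <= \sum_(x <- s) \sum_(y <- s) (gegenbauer n j).[inner_product x y].
  move=> c0 F0 GF; rewrite (eq_big_seq (fun x => c * \sum_(y <- s) F x y)).
    by rewrite -mulr_sumr mulr_ge0.
  by move=> x xs; rewrite mulr_sumr; apply: eq_big_seq => y ys; apply: GF.
pose fs : seq ('I_n -> R) := [seq x 0 | x : 'rV[R]_n <- s].
case: j j5 scaled => [|[|[|[|[|//]]]]] _ scaled.
- by do 2!apply: sumr_ge0 => ? _; rewrite /= hornerE.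
- apply: (scaled (fun x y => \sum_i x 0 i * y 0 i) 1) => //.
    exact: (gram_sum_ge0 (fun (x : 'rV[R]_n) i => x 0 i)).
  by move=> x y _ _; rewrite /= hornerE mul1r.
- apply: (scaled (fun x y =>
      sum2 (fun i j => tensor2 (x 0) i j * tensor2 (y 0) i j))
      (n%:R / (n%:R - 1))).
  + by apply: divr_ge0; lra.
  + have := tensor2_gram_ge0 fs; rewrite big_map.
    by under eq_bigr do rewrite big_map.
  + by move=> x y /s1 x1 /s1 y1; rewrite gegenbauer2E dot_tensor2//; lia.
- apply: (scaled (fun x y =>
      sum3 (fun i j k => tensor3 (x 0) i j k * tensor3 (y 0) i j k))
      ((n%:R + 2) / (n%:R - 1))).
  + by apply: divr_ge0; lra.
  + have := tensor3_gram_ge0 fs; rewrite big_map.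
    by under eq_bigr do rewrite big_map.
  + by move=> x y /s1 x1 /s1 y1; rewrite gegenbauer3E dot_tensor3.
- apply: (scaled (fun x y =>
      sum4 (fun i j k l => tensor4 (x 0) i j k l * tensor4 (y 0) i j k l))
      ((n%:R + 2) * (n%:R + 4) / ((n%:R - 1) * (n%:R + 1)))).
  + by apply: divr_ge0; apply: mulr_ge0; lra.
  + have := tensor4_gram_ge0 fs; rewrite big_map.
    by under eq_bigr do rewrite big_map.
  + by move=> x y /s1 x1 /s1 y1; rewrite gegenbauer4E dot_tensor4.
Qed.

(** * The linear programming bound and the polynomials it is applied to *)

Lemma delsarte_bound (p : {poly R}) (s : seq 'rV[R]_n) :
  uniq s -> (forall x, x \in s -> inner_product x x = 1) ->
  {in s &, forall x y, x != y -> p.[inner_product x y] = 0} ->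
  (size p <= 5)%N ->
  (forall j, (j < size p)%N -> 0 <= gegenbauer_coef n p j) ->
  0 < gegenbauer_coef n p 0 ->
  (size s)%:R <= p.[1] / gegenbauer_coef n p 0.
Proof.
move=> us s1 p0 p5; set f := gegenbauer_coef n p => f_ge0 f0_gt0.
have [pE fE] : gegenbauer_expansion n p f by exact: gegenbauer_coefP.
have energy : \sum_(x <- s) \sum_(y <- s) p.[inner_product x y]
    = (size s)%:R * p.[1].
  rewrite (eq_big_seq (fun=> p.[1])) => [|x xs].
    by rewrite big_const_seq count_predT iter_addr_0 mulr_natl.
  rewrite (bigD1_seq x)//= s1// big_seq_cond big1 ?addr0// => y /andP[ys yx].
  by apply: p0; rewrite // eq_sym.
have expansion : \sum_(x <- s) \sum_(y <- s) p.[inner_product x y]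
    = \sum_(j < size p) f j *
        \sum_(x <- s) \sum_(y <- s) (gegenbauer n j).[inner_product x y].
  under [RHS]eq_bigr do rewrite mulr_sumr.
  rewrite [RHS]exchange_big; apply: eq_bigr => x _.
  under [RHS]eq_bigr do rewrite mulr_sumr.
  rewrite [RHS]exchange_big; apply: eq_bigr => y _.
  by rewrite {1}pE horner_sum; apply: eq_bigr => j _; rewrite hornerZ.
(* The zero polynomial would have [f 0 = 0]; hence the term j = 0 exists and can be split off the
   expansion. *)
have p_gt0 : (0 < size p)%N.
  by rewrite ltnNge; apply/negP => /fE f00; rewrite f00 ltxx in f0_gt0.
have : f 0 * (size s)%:R ^+ 2 <= (size s)%:R * p.[1].
  rewrite -energy expansion (bigD1 (Ordinal p_gt0))//=.
  have -> : \sum_(x <- s) \sum_(y <- s) (1 : {poly R}).[inner_product x y]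
      = (size s)%:R ^+ 2.
    under eq_bigr do under eq_bigr do rewrite hornerC.
    under eq_bigr do rewrite big_const_seq count_predT iter_addr_0.
    by rewrite big_const_seq count_predT iter_addr_0 -mulrnA natrM expr2.
  (* The terms with j > 0 are dropped, being products of nonnegative factors. *)
  rewrite lerDl; apply: sumr_ge0 => j _; apply: mulr_ge0; first exact: f_ge0.
  by apply: gegenbauer_gram_ge0 => //; apply: leq_trans p5.
have [->|N0] := posnP (size s).
  (* For empty [s] the claim is [0 <= p.[1]], and [p.[1]] is the sum of the [f j]. *)
  move=> _; apply: divr_ge0; last exact: ltW.
  rewrite pE horner_sum; apply: sumr_ge0 => j _.
  by rewrite hornerZ gegenbauer_horner1 mulr1 f_ge0.
rewrite ler_pdivlMr// expr2 mulrCA ler_pM2l ?ltr0n//.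
by rewrite mulrC.
Qed.

(** Size 5 is degree 4, the last degree covered by [gegenbauer_gram_ge0]. *)
Lemma size_P_le5 (i : nat) (a b : R) : (size (P n i a b) <= 5)%N.
Proof.
have sM (p q : {poly R}) k l : (size p <= k.+1)%N -> (size q <= l)%N ->
    (size (p * q)%R <= k + l)%N.
  move=> pk ql; apply: leq_trans (size_polyMleq _ _) _; lia.
have sXB c : (size ('X - c%:P : {poly R})%R <= 2)%N by rewrite size_XsubC.
have sXD c : (size ('X + c%:P : {poly R})%R <= 2)%N by rewrite size_XaddC.
have s4 c d : (size ('X^2 + c *: 'X + d%:P : {poly R})%R <= 3)%N.
  rewrite -addrA; apply: leq_trans (size_polyD _ _) _.
  rewrite geq_max size_polyXn/=; apply: leq_trans (size_polyD _ _) _.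
  rewrite geq_max (leq_trans (size_scale_leq _ _)) ?size_polyX//=.
  by apply: leq_trans (size_polyC_leq1 _) _.
have sab c d : (size (('X - c%:P) * ('X - d%:P) : {poly R})%R <= 3)%N.
  exact: (@sM _ _ 1 2).
case: i => [|[|[|[|[|[|i]]]]]] /=; rewrite ?size_poly0//.
- by apply: leq_trans (sab _ _) _.
- by apply: leq_trans (@sM _ _ 2 2 (sab _ _) (sXD _)) _.
- rewrite /P3 -addrA -polyCD.
  by apply: leq_trans (@sM _ _ 2 2 (sab _ _) (sXD _)) _.
- exact: (@sM _ _ 2 3 (sab _ _) (s4 _ _)).
- exact: (@sM _ _ 2 3 (sab _ _) (s4 _ _)).
Qed.

Lemma P_root (i : nat) (a b t : R) : t = a \/ t = b -> (P n i a b).[t] = 0.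
Proof.
have ab : t = a \/ t = b -> (t - a) * (t - b) = 0.
  by case=> ->; rewrite subrr ?mul0r ?mulr0.
move=> /ab {}ab.
by case: i => [|[|[|[|[|[|i]]]]]] /=; rewrite ?horner0// !hornerM !hornerXsubC ab ?mul0r.
Qed.

End GegenbauerPositivity.

Theorem theorem5 (R : realType) (n : nat) (k a : R) (S : set 'rV[R]_n) :
  (2 <= n)%N -> 1 < k -> spherical_two_distance_set a (bk k a) S ->
  (counting S <= Q n k a)%E.
Proof.
move=> n2 _ [aI bI S1 Sab]; apply: le_bigmin => [|i _]; first exact: leey.
rewrite /Rk; case: asboolP => [[/= _ _ _ f_ge0 f0_gt0]|_]; last exact: leey.
(* The bound is stated for finite subsets because [S] is not known to be finite. *)
have bound (B : {fset 'rV[R]_n}) : [set` B] `<=` S ->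
    #|` B|%:R <= U n i a (bk k a).
  move=> BS; apply: delsarte_bound => //.
  - exact: fset_uniq.
  - by move=> x xB; apply: S1; apply: BS.
  - move=> x y xB yB /eqP xy; apply: P_root.
    by apply: Sab => //; apply: BS.
  - exact: size_P_le5.
rewrite /counting; case: asboolP => [Sfin|Sinf].
  by rewrite lee_fin bound// fset_setK.
(* An infinite [S] would contain a finite subset with more than [U n i a (bk k a)] elements, against
   [bound]. *)
have [B BS NB] := infinite_set_fset (Num.truncn (U n i a (bk k a))).+1 Sinf.
have : (Num.truncn (U n i a (bk k a))).+1%:R <= U n i a (bk k a).
  by apply: le_trans (bound B BS); rewrite ler_nat.
by rewrite leNgt truncnS_gt.
Qed.
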